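(* For every fixed integer $d\ge 2$, the maximal number of vertices of a $2$D-shadow of a $d$-dimensional dual zonotope with $n$ zones is $\Theta(n^{d-1})$. That is, let $M^*_d(n)$ denote the maximum, over all $d$-dimensional dual zonotopes $Z^*\subset\mathbb{R}^d$ with $n$ zones and all affine maps $\pi:\mathbb{R}^d\to\mathbb{R}^2$, of the number of vertices of $\pi(Z^* )$; then $M^*_d(n)=\Theta(n^{d-1})$ as $n\to\infty$, with implied constants depending only on $d$.
   Context: A $d$-dimensional dual zonotope with $n$ zones is a polytope of the form $Z^*=\{x\in\mathbb{R}^d:\sum_{i=1}^n|a_ix|\le 1\}$, where $a_1,\dots,a_n$ are row vectors that span $(\mathbb{R}^d)^*$, all nonzero and no one a scalar multiple of another. It is the polar dual of the zonotope $Z=\{\sum_{i=1}^n\lambda_ia_i:\lambda_i\in[-1,1]\}$. A $2$D-shadow of a polytope is its image under an affine map to $\mathbb{R}^2$. *)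

(* Defs.v *)
From HB Require Import structures.
From mathcomp Require Import all_boot all_order all_algebra.
From mathcomp Require Import all_classical all_reals all_analysis.

Set Implicit Arguments.
Unset Strict Implicit.
Unset Printing Implicit Defensive.

Import Order.TTheory GRing.Theory Num.Theory.
Import numFieldNormedType.Exports.

Local Open Scope classical_set_scope.
Local Open Scope ring_scope.

(* The zones a_1, ..., a_n are the rows of [a], seen as linear functionals on
   column vectors; [row_full a] says that they span the dual space. *)
Definition zone_vectors (R : realType) (d n : nat) (a : 'M[R]_(n, d)) : Prop :=
  [/\ row_full a,
      forall i, row i a != 0 &
      forall i j, i != j -> forall t : R, row i a != t *: row j a].

Definition dual_zonotope (R : realType) (d n : nat) (Z : set 'cV[R]_d) : Prop :=
  exists2 a : 'M[R]_(n, d), zone_vectors a &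
    Z = [set x | \sum_(i < n) `|(row i a *m x) 0 0| <= 1].

Definition face (R : realType) (m : nat) (P F : set 'cV[R]_m) : Prop :=
  exists (c : 'rV[R]_m) (c0 : R),
    (forall x, P x -> (c *m x) 0 0 <= c0) /\
    F = P `&` [set x | (c *m x) 0 0 = c0].

(* Vertices are the zero-dimensional faces. *)
Definition vertices (R : realType) (m : nat) (P : set 'cV[R]_m) : set 'cV[R]_m :=
  [set v | face P [set v]].

Definition is_affine (R : realType) (d m : nat) (f : 'cV[R]_d -> 'cV[R]_m) : Prop :=
  exists (A : 'M[R]_(m, d)) (b : 'cV[R]_m), forall x, f x = A *m x + b.

Definition shadow2 (R : realType) (d : nat) (P : set 'cV[R]_d)
    (S : set 'cV[R]_2) : Prop :=
  exists2 f : 'cV[R]_d -> 'cV[R]_2, is_affine f & S = f @` P.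

(* The bound by [`I_k] in the second clause also asserts that every shadow has
   only finitely many vertices. *)
Definition max_shadow_vertices (R : realType) (d n k : nat) : Prop :=
  (exists (Z : set 'cV[R]_d) (S : set 'cV[R]_2),
     [/\ dual_zonotope n Z, shadow2 Z S & (vertices S #= `I_k)%card]) /\
  (forall (Z : set 'cV[R]_d) (S : set 'cV[R]_2),
     dual_zonotope n Z -> shadow2 Z S -> (vertices S #<= `I_k)%card).

(* Main.v *)
(* Upper bound: in the fibre of the dual zonotope over a vertex of a shadow, a
   point x annihilated by a maximal number of zones spans the common kernel of
   those zones; hence x is determined up to sign by d - 1 of them, and there
   are at most 2 n^(d-1) vertices.

   Lower bound: put d = D + 2, take m odd with (D + 1) m <= n, and split the
   zones into families j = 0, ..., D, family j consisting of
     (e^2)^j (x_(j+1) - k x_0 + e (-1)^k x_(j+2)),   k = 0, 1, ...,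
   with no last term for j = D. The first m zones of each family cut the chart
   x_0 = 1 into a slightly deformed m x ... x m grid. Each of its m^(D+1)
   vertices survives the projection to (x_0, x_1): we need a
   functional of the form sum_i s_i a_i, with s_i the sign of a_i at the grid
   point and |s_i| < 1 where a_i vanishes, that depends on x_0 and x_1 only.
   In the coordinate x_(j+2) the perturbations of family j cancel, because they
   alternate and m is odd; the contribution of family j + 1 is at most
   (n + 1) (e^2)^(j+1), less than the size e (e^2)^j of the perturbations, so it
   is balanced by a coefficient s_i in ]-1, 1[ at the zone of family j through
   the grid point. *)
Require Import Defs.
From HB Require Import structures.
From mathcomp Require Import all_boot all_order all_algebra.
From mathcomp Require Import all_classical all_reals all_analysis.
From mathcomp Require Import ring lra zify.
Set Implicit Arguments.
Unset Strict Implicit.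
Unset Printing Implicit Defensive.

Import Order.TTheory GRing.Theory Num.Theory.
Import numFieldNormedType.Exports.
Local Open Scope classical_set_scope.
Local Open Scope ring_scope.

(** * The gauge of a dual zonotope, and kernels of full-rank matrices *)

Definition zone_norm (R : realType) (d n : nat) (a : 'M[R]_(n, d))
  (x : 'cV[R]_d) : R := \sum_(i < n) `|(a *m x) i 0|.

Lemma dual_zonotopeE (R : realType) (d n : nat) (a : 'M[R]_(n, d)) :
  [set x : 'cV[R]_d | \sum_(i < n) `|(row i a *m x) 0 0| <= 1] =
  [set x | zone_norm a x <= 1].
Proof.
apply/seteqP; split=> x /=; rewrite /zone_norm;
  by under eq_bigr => i _ do rewrite -row_mul mxE.
Qed.

Lemma row_full_ker0 (F : fieldType) (n d : nat) (a : 'M[F]_(n, d)) :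
  row_full a -> forall x : 'cV[F]_d, a *m x = 0 -> x = 0.
Proof. by move=> /row_fullP[b ba] x ax0; rewrite -(mul1mx x) -ba -mulmxA ax0 mulmx0. Qed.

Lemma ker0_row_full (F : fieldType) (n d : nat) (a : 'M[F]_(n, d)) :
  (forall x : 'cV[F]_d, a *m x = 0 -> x = 0) -> row_full a.
Proof.
move=> inj_a; rewrite -(trmxK a) /row_full mxrank_tr -/(row_free a^T).
rewrite -kermx_eq0; apply/eqP/row_matrixP => i; rewrite row0.
apply: trmx_inj; rewrite trmx0; apply: inj_a; apply: trmx_inj.
by rewrite trmx_mul trmxK -row_mul mulmx_ker row0 trmx0.
Qed.

Lemma card_setT_fintype (T : finType) : ([set: T] #= `I_#|T|)%card.
Proof.
apply: card_eq_trans (card_esym card_II).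
apply: (card_eq_trans (B := enum_rank @` [set: T])).
  by apply: card_esym; apply: inj_card_eq => x y _ _; apply: enum_rank_inj.
suff -> : enum_rank @` [set: T] = [set: 'I_#|T|] by apply: card_eqxx.
by apply/seteqP; split=> // k _; exists (enum_val k) => //; apply: enum_valK.
Qed.

(** * Shadows have few vertices *)

Section Shadow.
Variables (R : realType) (d n : nat) (a : 'M[R]_(n, d)).
Local Notation N := (zone_norm a).
Variables (A : 'M[R]_(2, d)) (b : 'cV[R]_2).
Local Notation S := ((fun x => A *m x + b) @` [set x : 'cV[R]_d | N x <= 1]).

Let rowD (x y : 'cV[R]_d) i : (a *m (x + y)) i 0 = (a *m x) i 0 + (a *m y) i 0.
Proof. by rewrite mulmxDr mxE. Qed.

Let rowZ t (x : 'cV[R]_d) i : (a *m (t *: x)) i 0 = t * (a *m x) i 0.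
Proof. by rewrite -scalemxAr mxE. Qed.

Lemma zone_normZ t x : N (t *: x) = `|t| * N x.
Proof.
by rewrite /zone_norm mulr_sumr; apply: eq_bigr => i _; rewrite rowZ normrM.
Qed.

Lemma zone_normD x y : N (x + y) <= N x + N y.
Proof.
rewrite /zone_norm -big_split; apply: ler_sum => i _.
by rewrite rowD ler_normD.
Qed.

Lemma zone_norm_ge0 x : 0 <= N x.
Proof. exact: sumr_ge0. Qed.

(** The images of [x + y] and [x - y] lie in [S] with midpoint [v]. The functional exposing [v] is
    maximal at the midpoint, hence at both images, so both equal [v]. *)
Lemma vertex_fiber v x y : vertices S v -> A *m x + b = v ->
  N (x + y) <= 1 -> N (x - y) <= 1 -> A *m y = 0.
Proof.
move=> [c [c0 [cS Sv]]] xv Np Nm.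
have Pp : S (A *m (x + y) + b) by exists (x + y).
have Pm : S (A *m (x - y) + b) by exists (x - y).
have [_ /= cv] : (S `&` [set x | (c *m x) 0 0 = c0]) v by rewrite -Sv.
have cp := cS _ Pp; have cm := cS _ Pm.
have Ep : A *m (x + y) + b = v + A *m y by rewrite -xv mulmxDr addrAC.
have Em : A *m (x - y) + b = v - A *m y by rewrite -xv mulmxBr addrAC.
rewrite Ep mulmxDr mxE cv in cp; rewrite Em mulmxBr !mxE in cm cp; rewrite mxE in cv.
have ceq : (c *m (A *m y)) 0 0 = 0 by rewrite !mxE; lra.
have : [set v] (v + A *m y).
  rewrite Sv; split; first by rewrite -Ep.
  by rewrite /= mulmxDr mxE ceq mxE cv addr0.
by move=> /= /eqP; rewrite -subr_eq0 addrC addKr => /eqP.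
Qed.

Hypothesis a_full : row_full a.

(** Take [x] in the dual zonotope and in the fibre over [v], with as many vanishing zones as
    possible. The last clause says that the zones vanishing at [x] have the line through [x] as
    common kernel. *)
Lemma vertex_preimage v : A != 0 -> vertices S v ->
  exists x, [/\ A *m x + b = v, N x = 1 &
    forall y, (forall i, (a *m x) i 0 = 0 -> (a *m y) i 0 = 0) ->
      exists t, y = t *: x].
Proof.
move=> A0 Vv.
have [x0 x0P x0v] : S v.
  by have [c [c0 [_ Sv]]] := Vv;
    have [] : (S `&` [set x | (c *m x) 0 0 = c0]) v by rewrite -Sv.
pose zeros (x : 'cV[R]_d) := #|[pred i | (a *m x) i 0 == 0]|.
pose Q k := `[< exists x, [/\ N x <= 1, A *m x + b = v & zeros x = k] >].
have exQ : exists k, Q k by exists (zeros x0); apply/asboolP; exists x0.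
have ubQ k : Q k -> (k <= n)%N.
  by move=> /asboolP[x [_ _ <-]]; rewrite -[X in (_ <= X)%N]card_ord max_card.
have [k /asboolP[x [Nx xv zx]] kmax] := ex_maxnP exQ ubQ.
have Nx1 : N x = 1.
  apply/eqP; rewrite eq_le Nx /= leNgt; apply/negP => Nlt.
  move/eqP: A0; apply; apply/matrixP => i j; rewrite [RHS]mxE.
  (* If [N x < 1], then [x + s e] and [x - s e] stay in the dual zonotope, so [A] kills every basis
     vector [e], against [A != 0]. The [+ 1] keeps the denominator positive. *)
  pose e : 'cV[R]_d := delta_mx j 0; pose s := (1 - N x) / (N e + 1).
  have Ne := zone_norm_ge0 e.
  have s0 : 0 < s by by rewrite divr_gt0 ?subr_gt0 // ltr_wpDl.
  have sN : `|s| * N e <= 1 - N x.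
    rewrite gtr0_norm // /s mulrAC ler_pdivrMr; last by rewrite ltr_wpDl.
    by rewrite ler_wpM2l ?subr_ge0 // lerDl.
  have Ae : A *m (s *: e) = 0.
    apply: (vertex_fiber Vv xv).
    - by apply: le_trans (zone_normD _ _) _; rewrite zone_normZ -lerBrDl.
    - by apply: le_trans (zone_normD _ _) _; rewrite -scaleNr zone_normZ normrN -lerBrDl.
  move: Ae => /matrixP /(_ i 0); rewrite -scalemxAr /e -colE !mxE => /eqP.
  by rewrite mulf_eq0 gt_eqF //= => /eqP.
exists x; split=> // y hy.
(* [L] is linear and agrees with [N] at every point where each zone vanishes or has the same sign as
   at [x]. *)
pose L (z : 'cV[R]_d) := \sum_(i < n) Num.sg ((a *m x) i 0) * (a *m z) i 0.
have LD z w : L (z + w) = L z + L w.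
  by rewrite /L -big_split; apply: eq_bigr => i _; rewrite rowD mulrDr.
have LZ t z : L (t *: z) = t * L z.
  by rewrite /L mulr_sumr; apply: eq_bigr => i _; rewrite rowZ mulrCA.
have Lx : L x = 1.
  by rewrite -Nx1 /zone_norm; apply: eq_bigr => i _; rewrite [in RHS]normrEsg.
(* Otherwise x can be moved within its fibre along w, keeping the norm 1, until
   one more zone vanishes. *)
exists (L y); apply/eqP; rewrite -subr_eq0; apply/negPn/negP => w0.
set w := y - L y *: x in w0.
have Lw : L w = 0 by rewrite /w LD -scaleNr LZ Lx mulr1 subrr.
have hw i : (a *m x) i 0 = 0 -> (a *m w) i 0 = 0.
  by move=> h; rewrite /w -scaleNr rowD rowZ h hy // mulr0 addr0.
have [i0 wi0] : exists i, (a *m w) i 0 != 0.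
  apply/existsP; rewrite -negb_forall; apply/negP => /forallP h.
  move/eqP: w0; apply; apply: (row_full_ker0 a_full).
  by apply/matrixP => i j; rewrite ord1 [RHS]mxE (eqP (h i)).
(* Zone [i] cannot change sign along [x + s w] while [|s| <= r i]; up to the smallest such bound [N]
   equals [L], which is constant on this line. *)
pose r i := `|(a *m x) i 0| / `|(a *m w) i 0|.
have [i1 wi1 rmin] :=
  arg_minP r (wi0 : [pred i | (a *m w) i 0 != 0] i0).
have xi1 : (a *m x) i1 0 != 0 by apply: contra wi1 => /eqP /hw ->.
have small s : `|s| <= r i1 -> N (x + s *: w) = 1.
  move=> hs; transitivity (L (x + s *: w)); last by rewrite LD LZ Lx Lw mulr0 addr0.
  rewrite /zone_norm; apply: eq_bigr => i _.
  rewrite rowD rowZ.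
  set u := (a *m x) i 0; set z := (a *m w) i 0.
  have [z0|z0] := eqVneq z 0.
    by rewrite z0 mulr0 addr0 normrEsg.
  have sz : `|s * z| <= `|u|.
    rewrite normrM -ler_pdivlMr ?normr_gt0 //.
    by apply: le_trans hs _; apply: rmin.
  have u0 : u != 0 by apply: contra z0 => /eqP /hw /eqP.
  move: sz; rewrite ler_norml => /andP[].
  case: (ltgtP u 0) u0 => // hu _; rewrite ?(ltr0_norm hu) ?(gtr0_norm hu) ?opprK => h1 h2.
    by rewrite ltr0_sg // mulN1r ler0_norm // -lerBrDl sub0r.
  by rewrite gtr0_sg // mul1r ger0_norm // -lerBlDl sub0r.
(* The sign of [t] is the one for which zone [i1] vanishes at [x + t w]. *)
pose t := - ((a *m x) i1 0 / (a *m w) i1 0).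
have tr : `|t| <= r i1 by rewrite /t normrN normrM normfV.
have Aw : A *m (t *: w) = 0.
  by apply: (vertex_fiber Vv xv); rewrite -?scaleNr small // normrN.
have : Q (zeros (x + t *: w)).
  by apply/asboolP; exists (x + t *: w); rewrite small // mulmxDr Aw addr0.
move=> /kmax; rewrite -zx leqNgt => /negP; apply.
apply: proper_card; apply/properP; split.
  apply/fintype.subsetP => i; rewrite !inE => /eqP h.
  by rewrite rowD rowZ h (hw _ h) mulr0 addr0.
exists i1; rewrite !inE //.
by rewrite rowD rowZ /t mulNr divfK // subrr.
Qed.

(** Replace by 0 the rows of [a] that do not vanish at [x]. The resulting [B] has the line through
    [x] as kernel, hence rank [d - 1], and a maximal independent set of its rows has the same
    kernel. *)
Lemma spanning_zero_rows (x : 'cV[R]_d) : x != 0 ->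
  (forall y, (forall i, (a *m x) i 0 = 0 -> (a *m y) i 0 = 0) ->
    exists t, y = t *: x) ->
  exists g : {ffun 'I_d.-1 -> 'I_n}, (forall i, (a *m x) (g i) 0 = 0) /\
    forall y, (forall i, (a *m y) (g i) 0 = 0) -> exists t, y = t *: x.
Proof.
move=> x0 hx.
pose B : 'M[R]_(n, d) := \matrix_i (if (a *m x) i 0 == 0 then row i a else 0).
have Brow y i : (B *m y) i 0 = if (a *m x) i 0 == 0 then (a *m y) i 0 else 0.
  have -> : (B *m y) i 0 = (row i B *m y) 0 0 by rewrite -row_mul [RHS]mxE.
  rewrite rowK; case: ifP => _; last by rewrite mul0mx mxE.
  by rewrite -row_mul [LHS]mxE.
have Bx : B *m x = 0.
  by apply/matrixP => i j; rewrite ord1 Brow [RHS]mxE; case: eqP.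
have kerB y : B *m y = 0 -> exists t, y = t *: x.
  move=> By; apply: hx => i axi.
  by move/matrixP: By => /(_ i 0); rewrite Brow axi eqxx => ->; rewrite mxE.
have rB : \rank B = d.-1.
  have : \rank (kermx B^T) = 1%N.
    apply/eqP; rewrite eqn_leq; apply/andP; split.
      apply: leq_trans (rank_leq_row x^T); apply: mxrankS.
      apply/row_subP => i.
      have [t ht] : exists t, (row i (kermx B^T))^T = t *: x.
        apply: kerB; apply: trmx_inj.
        by rewrite trmx_mul trmxK -row_mul mulmx_ker row0 trmx0.
      by rewrite -[row _ _]trmxK ht linearZ /= scalemx_sub.
    have -> : 1%N = \rank x^T by rewrite rank_rV trmx_eq0 x0.
    by apply: mxrankS; apply/sub_kermxP; rewrite -trmx_mul Bx trmx0.
  by rewrite mxrank_ker mxrank_tr => h; rewrite -subn1 -h subKn // rank_leq_col.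
pose f i := maxrankfun B (cast_ord (esym rB) i).
(* A row chosen by [maxrankfun] is nonzero, since the chosen rows are independent; so it is not one
   of the rows replaced by 0. *)
have fB i : (a *m x) (f i) 0 = 0.
  apply/eqP/negPn/negP => /negPf afi.
  have := maxrowsub_free B; set k := cast_ord (esym rB) i => /row_freeP[C BC].
  have := congr1 (row k) BC; rewrite row_mul row_rowsub rowK afi mul0mx.
  by move=> /matrixP/(_ 0 k)/eqP; rewrite !mxE eqxx eq_sym oner_eq0.
exists [ffun i => f i]; split=> [i|y hy]; first by rewrite ffunE.
apply: kerB; have /submxP[C ->] : (B <= rowsub (maxrankfun B) B)%MS.
  by rewrite eq_maxrowsub.
suff -> : C *m rowsub (maxrankfun B) B *m y = C *m 0 by rewrite mulmx0.
rewrite -mulmxA; congr (_ *m _); apply/matrixP => i j; rewrite ord1 [RHS]mxE.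
have -> : (rowsub (maxrankfun B) B *m y) i 0 = (B *m y) (maxrankfun B i) 0.
  have -> (k : nat) (M : 'M[R]_(k, d)) j' : (M *m y) j' 0 = (row j' M *m y) 0 0.
    by rewrite -row_mul [RHS]mxE.
  by rewrite row_rowsub -row_mul mxE.
by rewrite Brow; have := hy (cast_ord rB i); rewrite ffunE /f cast_ordK => ->; case: ifP.
Qed.

Lemma card_shadow_vertices : (0 < n)%N ->
  (vertices S #<= `I_(2 * n ^ d.-1))%card.
Proof.
move=> n0.
pose P (g : {ffun 'I_d.-1 -> 'I_n}) (x : 'cV[R]_d) :=
  zone_norm a x = 1 /\ forall i, (a *m x) (g i) 0 = 0.
(* A point of norm 1 killed by the zones in [g], or the default 0 if there is none. When these zones
   have a line as kernel, [X g] is determined up to sign. *)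
pose X g := xget 0 [set x | P g x].
pose F (u : bool * {ffun 'I_d.-1 -> 'I_n}) := A *m ((-1) ^+ u.1 *: X u.2) + b.
suff cover : vertices S `<=` F @` setT.
  apply: card_le_trans (subset_card_le cover) _.
  apply: card_le_trans (card_image_le F setT) _.
  have <- : #|{: bool * {ffun 'I_d.-1 -> 'I_n}}| = (2 * n ^ d.-1)%N.
    by rewrite card_prod card_bool card_ffun !card_ord.
  by have := card_setT_fintype (bool * {ffun 'I_d.-1 -> 'I_n})%type;
    rewrite card_eq_le => /andP[].
move=> v Vv; have [A0|A0] := eqVneq A 0.
  (* For a constant map the only point of the shadow is [b], so any index serves. *)
  exists (true, [ffun=> Ordinal n0]) => //.
  have [c [c0 [_ Sv]]] := Vv.
  have [[x _ <-] _] : (S `&` [set x | (c *m x) 0 0 = c0]) v by rewrite -Sv.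
  by rewrite /F A0 !mul0mx.
have [x [xv Nx hx]] := vertex_preimage A0 Vv.
have x0 : x != 0.
  apply/eqP => x0; move: Nx; rewrite x0 -(scale0r 0) zone_normZ normr0 mul0r.
  by move/eqP; rewrite eq_sym oner_eq0.
have [g [gx hg]] := spanning_zero_rows x0 hx.
have [NX gX] : P g (X g).
  by have : [set x | P g x] x by []; move=> /(xgetI (0 : 'cV[R]_d)).
have [t Xt] := hg _ gX.
have t1 : `|t| = 1 by move: NX; rewrite Xt zone_normZ Nx mulr1.
(* As [|t| = 1], the sign [(-1) ^+ (t < 0)] turns [t *: x] back into [x]. *)
exists (t < 0, g) => //; rewrite /F /= Xt scalerA -xv; congr (_ *m _ + _).
by rewrite -normrEsign t1 scale1r.
Qed.

End Shadow.

(** * A certificate for vertices of shadows *)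

Section Certificate.
Variables (R : realType) (d n : nat) (a : 'M[R]_(n, d)).
Variables (A : 'M[R]_(2, d)) (b : 'cV[R]_2).
Local Notation S := ((fun x => A *m x + b) @` [set x : 'cV[R]_d | zone_norm a x <= 1]).

(** The functional [s *m a] is at most [N] everywhere and factors through [A] as [c]. If it equals 1
    at some [y] with [N y <= 1], then every zone with [|s 0 i| < 1] vanishes at [y], so [y] is a
    multiple of [x], hence [x] itself. Thus [c] exposes the image of [x], and the fibre over it is a
    single point. *)
Lemma certified_vertex (s : 'rV[R]_n) (c : 'rV[R]_2) (x : 'cV[R]_d) :
  (forall i, `|s 0 i| <= 1) ->
  (forall i, s 0 i * (a *m x) i 0 = `|(a *m x) i 0|) ->
  zone_norm a x = 1 -> s *m a = c *m A ->
  (forall y, (forall i, `|s 0 i| < 1 -> (a *m y) i 0 = 0) ->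
    exists t, y = t *: x) ->
  vertices S (A *m x + b) /\
  forall y, zone_norm a y <= 1 -> A *m y + b = A *m x + b -> y = x.
Proof.
move=> s1 sx Nx sA hx.
have cE y : (c *m (A *m y)) 0 0 = \sum_i s 0 i * (a *m y) i 0.
  by rewrite mulmxA -sA -mulmxA mxE.
have term_le y i : s 0 i * (a *m y) i 0 <= `|(a *m y) i 0|.
  by apply: le_trans (ler_norm _) _; rewrite normrM ler_piMl.
have cx : (c *m (A *m x)) 0 0 = 1.
  by rewrite cE -Nx; apply: eq_bigr.
have c_le y : zone_norm a y <= 1 -> (c *m (A *m y)) 0 0 <= 1.
  by apply: le_trans; rewrite cE; apply: ler_sum.
have c_eq y : zone_norm a y <= 1 -> (c *m (A *m y)) 0 0 = 1 -> y = x.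
  move=> Ny cy.
  have eq_term i : s 0 i * (a *m y) i 0 = `|(a *m y) i 0|.
    apply/esym/eqP; rewrite -subr_eq0; apply/eqP.
    have ge0 (j : 'I_n) : true -> 0 <= `|(a *m y) j 0| - s 0 j * (a *m y) j 0.
      by rewrite subr_ge0.
    apply: (psumr_eq0P ge0) => //; apply/eqP; rewrite eq_le sumr_ge0 // andbT.
    by rewrite big_split /= sumrN -cE cy subr_le0.
  have [t yt] : exists t, y = t *: x.
    apply: hx => i si; apply/eqP; rewrite -normr_eq0; apply/negPn/negP => ay0.
    have : `|(a *m y) i 0| <= `|s 0 i| * `|(a *m y) i 0|.
      by rewrite -normrM -{1}eq_term ler_norm.
    by rewrite ler_pMl ?lt_def ?ay0 ?normr_ge0 // leNgt si.
  move: cy; rewrite yt -!scalemxAr mxE cx mulr1 => ->; exact: scale1r.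
have Ax_inj y : A *m y + b = A *m x + b -> (c *m (A *m y)) 0 0 = 1.
  by move/addIr => ->.
split; last by move=> y Ny /Ax_inj /(c_eq _ Ny).
exists c, (1 + (c *m b) 0 0); split.
  by move=> _ [y Ny <-]; rewrite mulmxDr mxE lerD2r c_le.
apply/seteqP; split=> [_ ->|_ [[y Ny <-]]] /=.
  by split; [exists x; rewrite //= Nx | rewrite mulmxDr mxE cx].
by rewrite mulmxDr mxE => /addIr /(c_eq _ Ny) ->.
Qed.

End Certificate.

(** Solves triangular systems from the last unknown down while keeping a bound [P]; used for the
    coordinates of a grid point and for the free coefficients of its certificate. *)
Lemma backward_recursion (V : Type) (N : nat) (g : nat -> V -> V) (P : V -> Prop)
    (v0 : V) :
  P v0 -> (forall j v, (j < N)%N -> P v -> P (g j v)) ->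
  exists u : nat -> V, [/\ forall j, (j <= N)%N -> P (u j), u N = v0 &
    forall j, (j < N)%N -> u j = g j (u j.+1)].
Proof.
move=> P0; elim: N g => [|N IHN] g gP.
  by exists (fun=> v0); split.
have [|u [uP uN ug]] := IHN (fun j => g j.+1); first by move=> j v; apply: (gP j.+1 v).
exists (fun j => if j is j'.+1 then u j' else g 0%N (u 0%N)); split=> // -[|j] //.
- by move=> _; apply: gP => //; apply: uP.
- exact: uP.
- exact: ug.
Qed.

(** For [p < q] with [q] odd the sum is 0 whatever [p] is; this is why the grid size is odd. *)
Lemma alternating_sum (R : pzRingType) (p q : nat) :
  \sum_(k < q) ((k < p)%:R - (p < k)%:R) * (-1) ^+ k =
  (if (q <= p)%N then odd q else ~~ odd q)%:R :> R.
Proof.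
elim: q => [|q IHq]; first by rewrite big_ord0.
rewrite big_ord_recr /= IHq -signr_odd.
case: (ltngtP q p) => [_|_|->]; case: (odd _); rewrite /= ?negbK.
all: rewrite ?expr1 ?expr0 ?mulrN1 ?mulr1 ?subr0 ?sub0r ?opprK ?subrr ?oppr0.
all: by rewrite ?addr0 ?add0r ?subrr.
Qed.

(** * The deformed grid *)

Section Grid.
Variables (R : realType) (D m n : nat).
Hypotheses (m_odd : odd m) (Dm_le_n : (D.+1 * m <= n)%N) (D2_le_n : (D.+2 <= n)%N).

(** Zones are numbered in blocks of length [m]. The minimum puts all leftover indices into family
    [D], which may therefore be longer than the others. *)
Definition family (i : nat) := minn (i %/ m) D.
Definition offset (i : nat) := (i - family i * m)%N.

Let m_gt0 : (0 < m)%N. Proof. exact: odd_gt0. Qed.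

Lemma family_le i : (family i <= D)%N.
Proof. exact: geq_minr. Qed.

Lemma family_offset i : (family i * m + offset i)%N = i.
Proof.
rewrite subnKC // (leq_trans _ (leq_divM i m)) //.
by rewrite leq_mul2r geq_minl orbT.
Qed.

Lemma family_mul_add j k : (j <= D)%N -> (k < m)%N \/ j = D ->
  family (j * m + k) = j.
Proof.
rewrite /family divnMDl // => jD [km|->].
  by rewrite divn_small // addn0; apply/minn_idPl.
by apply/minn_idPr; rewrite leq_addr.
Qed.

Lemma offset_mul_add j k : (j <= D)%N -> (k < m)%N \/ j = D ->
  offset (j * m + k) = k.
Proof. by move=> jD h; rewrite /offset family_mul_add // addKn. Qed.

Lemma offset_lt i : (family i < D)%N -> (offset i < m)%N.
Proof.
rewrite /offset /family => h; have -> : minn (i %/ m) D = (i %/ m)%N.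
  by apply/minn_idPl; move: h; rewrite gtn_min ltnn orbF => /ltnW.
by rewrite {1}(divn_eq i m) addKn ltn_mod.
Qed.

Lemma grid_index_lt j k : (j <= D)%N -> (k < m)%N -> (j * m + k < n)%N.
Proof.
move=> jD km; apply: leq_trans Dm_le_n; rewrite mulSn addnC -addSn.
by rewrite leq_add // leq_mul2r jD orbT.
Qed.

Lemma exists_zone j k : (j <= D)%N -> (k < m)%N ->
  exists2 i : 'I_n, family i = j & offset i = k.
Proof.
move=> jD km; exists (Ordinal (grid_index_lt jD km)) => /=.
  by apply: family_mul_add => //; left.
by apply: offset_mul_add => //; left.
Qed.

(** Even for [m = 1] the last family has two zones, because [D.+2 <= n]; without two of them the
    zones would not detect coordinate 0 in [grid_zones_full]. *)
Lemma exists_last_zone k : (k < 2)%N ->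
  exists2 i : 'I_n, family i = D & offset i = k.
Proof.
move=> k2; have lt_n : (D * m + k < n)%N.
  move: m_gt0 Dm_le_n; case: (ltnP k m) => [km *|mk]; first exact: grid_index_lt.
  case: k k2 mk => [|[|]] // _; first by rewrite leqn0 => /eqP ->.
  by case: m => [|[|]] // _ _ _; rewrite muln1 addn1.
exists (Ordinal lt_n) => /=; first by apply: family_mul_add; rewrite ?leqnn //; right.
by apply: offset_mul_add; rewrite ?leqnn //; right.
Qed.

Lemma sum_family (F : nat -> R) j : (j < D)%N ->
  \sum_(i < n | family i == j) F (offset i) = \sum_(k < m) F k.
Proof.
move=> jD; have jD' := ltnW jD.
pose h (k : 'I_m) : 'I_n := Ordinal (grid_index_lt jD' (ltn_ord k)).
pose h' (i : 'I_n) : 'I_m := insubd (Ordinal m_gt0) (offset i).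
have h'K (i : 'I_n) : family i == j -> h (h' i) = i.
  move=> /eqP fi; apply: val_inj; rewrite /= val_insubd offset_lt ?fi //.
  by rewrite -fi family_offset.
rewrite (reindex_onto h h' h'K); apply: eq_big => k; last first.
  by rewrite /= offset_mul_add //; left.
rewrite /= family_mul_add ?eqxx //=; last by left.
apply/eqP; apply: val_inj; rewrite val_insubd /= offset_mul_add //; last by left.
by rewrite ltn_ord.
Qed.

Lemma sum_family_offset (F : nat -> R) j (k : nat) : (j <= D)%N -> (k < m)%N ->
  \sum_(i < n | family i == j) (offset i == k)%:R * F (offset i) = F k.
Proof.
move=> jD km; have [i0 f0 o0] := exists_zone jD km.
rewrite (bigD1 i0) ?f0 //= o0 eqxx mul1r big1 ?addr0 // => i /andP[/eqP fi ii0].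
case: eqP => [oi|]; last by rewrite mul0r.
by case/eqP: ii0; apply: val_inj;
  rewrite /= -(family_offset i) -(family_offset i0) fi f0 oi o0.
Qed.

(** * The zones in coordinates *)

Variable e : R.
Hypotheses (e_gt0 : 0 < e) (e_small : e * (2 * n.+1%:R) < 1).

Definition grid_zones : 'M[R]_(n, D.+2) := \matrix_(i, c)
  ((e ^+ 2) ^+ family i *
   ((c == (family i).+1 :> nat)%:R - (offset i)%:R * (c == 0 :> nat)%:R
    + e * (-1) ^+ offset i * (c == (family i).+2 :> nat)%:R)).

(* The value 0 at index D.+2 lets the last family, which is unperturbed, share
   the formula of the others. *)
Definition coord (y : 'cV[R]_D.+2) (c : nat) : R :=
  if (c < D.+2)%N then y (inord c) 0 else 0.

Lemma sum_coord (y : 'cV[R]_D.+2) (q : nat) :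
  \sum_(c < D.+2) (c == q :> nat)%:R * y c 0 = coord y q.
Proof.
rewrite /coord; case: ifP => hq; last first.
  apply: big1 => c _; case: eqP => [cq|]; last by rewrite mul0r.
  by move: hq; rewrite -cq ltn_ord.
rewrite (bigD1 (inord q)) //= inordK // eqxx mul1r big1 ?addr0 // => c cq.
case: eqP => [cq'|]; last by rewrite mul0r.
by case/eqP: cq; apply: val_inj; rewrite /= inordK.
Qed.

Lemma coordD (y z : 'cV[R]_D.+2) c : coord (y + z) c = coord y c + coord z c.
Proof. by rewrite /coord; case: ifP; rewrite ?mxE ?addr0. Qed.

Lemma coordZ t (y : 'cV[R]_D.+2) c : coord (t *: y) c = t * coord y c.
Proof. by rewrite /coord; case: ifP; rewrite ?mxE ?mulr0. Qed.

Lemma grid_zonesE (y : 'cV[R]_D.+2) (i : 'I_n) : (grid_zones *m y) i 0 =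
  (e ^+ 2) ^+ family i * (coord y (family i).+1 - (offset i)%:R * coord y 0
    + e * (-1) ^+ offset i * coord y (family i).+2).
Proof.
rewrite mxE -!sum_coord !mulr_sumr -sumrN -!big_split mulr_sumr /=.
by apply: eq_bigr => c _; rewrite mxE; ring.
Qed.

Lemma grid_zones_eq0 (y : 'cV[R]_D.+2) (i : 'I_n) : ((grid_zones *m y) i 0 == 0) =
  (coord y (family i).+1 - (offset i)%:R * coord y 0
    + e * (-1) ^+ offset i * coord y (family i).+2 == 0).
Proof. by rewrite grid_zonesE mulf_eq0 !expf_eq0 gt_eqF //= !andbF. Qed.

(** Back substitution, starting from the value 0 at index [D.+2]. *)
Lemma coord_eq0 (w : nat -> R) (y : 'cV[R]_D.+2) : coord y 0 = 0 ->
  (forall j, (j <= D)%N -> coord y j.+1 + w j * coord y j.+2 = 0) -> y = 0.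
Proof.
move=> y0 hy.
have back r : (r <= D.+1)%N -> coord y (D.+2 - r) = 0.
  elim: r => [|r IHr] rD; first by rewrite /coord subn0 ltnn.
  have := hy (D - r)%N (leq_subr _ _).
  by rewrite -(subSn (rD : (r <= D)%N)) -(subSn (leqW rD)) subSS IHr ?mulr0 ?addr0 // ltnW.
apply/matrixP => c z; rewrite ord1 [RHS]mxE.
have -> : y c 0 = coord y c by rewrite /coord ltn_ord inord_val.
case: c => -[|c] /= hc; first by [].
by rewrite -(subKn (ltnW hc)) back // subSS leq_subr.
Qed.

(** In the unperturbed last family, offsets 0 and 1 differ by coordinate 0 up to a scalar, so that
    coordinate vanishes. The zones of offset 0 then give a triangular system. *)
Lemma grid_zones_full : row_full grid_zones.
Proof.
apply: ker0_row_full => y ay.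
have ayi i : (grid_zones *m y) i 0 == 0 by rewrite ay mxE.
have [i0 f0 o0] := exists_last_zone (isT : (0 < 2)%N).
have [i1 f1 o1] := exists_last_zone (isT : (1 < 2)%N).
have y0 : coord y 0 = 0.
  have := ayi i0; have := ayi i1; rewrite !grid_zones_eq0 f0 f1 o0 o1 => /eqP h1 /eqP h0.
  by move: h1 h0; rewrite [coord y D.+2]/coord ltnn; lra.
apply: (@coord_eq0 (fun=> e)) => // j jD.
have [i fi oi] := exists_zone jD m_gt0.
have := ayi i; rewrite grid_zones_eq0 fi oi y0 => /eqP <-.
by rewrite mulr0 subr0 expr0 mulr1.
Qed.

(** Proportional rows are excluded by comparing columns. Within one family, the leading column
    forces [t = 1] and column 0 equal offsets. Otherwise one of the two leading columns is zero in
    the other row. *)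
Lemma grid_zone_vectors : zone_vectors grid_zones.
Proof.
have lead (i : 'I_n) : grid_zones i (inord (family i).+1) != 0.
  rewrite mxE inordK ?ltnS ?family_le // eqxx (ltn_eqF (ltnSn _)) /= !mulr0 subr0 addr0 mulr1.
  by rewrite !expf_neq0 // gt_eqF.
have nz (i : 'I_n) : row i grid_zones != 0.
  apply: contraNneq (lead i) => /rowP /(_ (inord (family i).+1)).
  by rewrite [LHS]mxE => ->; rewrite mxE.
split=> // [|i i' ii' t]; first exact: grid_zones_full.
apply/eqP => /rowP itj.
have {}itj c : grid_zones i c = t * grid_zones i' c.
  by have := itj c; rewrite [LHS]mxE => ->; rewrite [LHS]mxE; congr (_ * _); rewrite [LHS]mxE.
have t0 : t != 0.
  by apply: contraNneq (lead i) => t0; rewrite itj t0 mul0r.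
have [eqf|nef] := eqVneq (family i) (family i').
  have lead1 := itj (inord (family i).+1).
  have t1 : t = 1.
    move: lead1; rewrite !mxE inordK ?ltnS ?family_le // -eqf eqxx (ltn_eqF (ltnSn _)) /=.
    rewrite !mulr0 !subr0 !addr0 !mulr1 -[LHS]mul1r => /mulIf -> //.
    by rewrite !expf_neq0 // gt_eqF.
  have := itj ord0; rewrite !mxE t1 -eqf /= mul1r => /mulfI.
  rewrite !expf_neq0 ?gt_eqF // !mulr0 !mulr1 !addr0 !sub0r => /(_ isT) /oppr_inj /eqP.
  rewrite eqr_nat => /eqP eqo; case/eqP: ii'; apply: val_inj => /=.
  by rewrite -(family_offset i) -(family_offset i') eqf eqo.
have [adj|nadj] := eqVneq (family i) (family i').+1.
  have := itj (inord (family i').+1); rewrite [LHS]mxE inordK ?ltnS ?family_le // -adj.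
  rewrite (ltn_eqF (ltnSn _)) (ltn_eqF (ltnW (ltnSn _.+1))) adj /= !mulr0 subr0 addr0 mulr0.
  by move/eqP; rewrite eq_sym mulf_eq0 (negPf t0) (negPf (lead i')).
have /eqP := itj (inord (family i).+1).
rewrite [X in _ * X]mxE inordK ?ltnS ?family_le // !eqSS (negPf nef) (negPf nadj) /=.
by rewrite !mulr0 subr0 addr0 !mulr0 (negPf (lead i)).
Qed.

(** Solve the equations of the zones at offsets [p j] from the last coordinate down; [u c] is
    coordinate [c.+1]. All [u c] have size at most [n + 1], so the perturbation shifts each zone, up
    to its positive weight, by less than 1 from the integer [p j - k], whose sign therefore
    decides. *)
Lemma grid_point (p : nat -> nat) : (forall j, (p j < m)%N) ->
  exists x : 'cV[R]_D.+2, [/\ coord x 0 = 1,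
    forall i : 'I_n, offset i = p (family i) -> (grid_zones *m x) i 0 = 0,
    forall i : 'I_n, (offset i < p (family i))%N -> 0 < (grid_zones *m x) i 0 &
    forall i : 'I_n, (p (family i) < offset i)%N -> (grid_zones *m x) i 0 < 0].
Proof.
move=> pm.
have n0 : 0 <= n%:R :> R by [].
have e1 : e * (n%:R + 1) < 1 / 2 by have := e_small; rewrite -[n.+1%:R]natr1; lra.
pose g j (v : R) := (p j)%:R - e * (-1) ^+ p j * v.
pose P (v : R) : Prop := `|v| <= n%:R + 1.
have pn j : (p j)%:R <= n%:R :> R.
  rewrite ler_nat (leq_trans (ltnW (pm j))) // (leq_trans _ Dm_le_n) //.
  by rewrite leq_pmull.
have ev v : P v -> `|e * v| < 1 / 2.
  move=> Pv; rewrite normrM gtr0_norm //; apply: le_lt_trans e1.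
  by rewrite ler_wpM2l // ltW.
have gP j v : (j < D.+1)%N -> P v -> P (g j v).
  move=> _ Pv; apply: le_trans (ler_normB _ _) _.
  rewrite normr_nat mulrAC normrM normr_sign mulr1; have := ev _ Pv.
  by have := pn j; lra.
have P0 : P 0 by rewrite /P normr0; lra.
have [u [uP uN ug]] := backward_recursion P0 gP.
pose x : 'cV[R]_D.+2 := \col_c (if (c : nat) is c'.+1 then u c' else 1).
have x0 : coord x 0 = 1 by rewrite /coord mxE inordK.
have xS c : (c <= D.+1)%N -> coord x c.+1 = u c.
  rewrite /coord !ltnS leq_eqVlt ltnS => /predU1P[->|cD]; first by rewrite ltnn uN.
  by rewrite cD mxE inordK ?ltnS.
have xi (i : 'I_n) : (grid_zones *m x) i 0 = (e ^+ 2) ^+ family i *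
    ((p (family i))%:R - (offset i)%:R
     + e * u (family i).+1 * ((-1) ^+ offset i - (-1) ^+ p (family i))).
  have fD := family_le i.
  rewrite grid_zonesE x0 !xS ?ltnS ?(leq_trans fD) // ug ?ltnS // /g; congr (_ * _); ring.
have h_gt0 (i : 'I_n) : 0 < (e ^+ 2) ^+ family i by rewrite !exprn_gt0.
have small (i : 'I_n) :
    `|e * u (family i).+1 * ((-1) ^+ offset i - (-1) ^+ p (family i))| < 1.
  rewrite normrM; apply: (@le_lt_trans _ _ (`|e * u (family i).+1| * 2)).
    rewrite ler_wpM2l //; apply: le_trans (ler_normB _ _) _.
    by rewrite !normr_sign.
  by have := ev _ (uP (family i).+1 (family_le i)); lra.
exists x; split=> // i hi.
- by rewrite xi hi !subrr mulr0 addr0 mulr0.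
- rewrite xi pmulr_rgt0 //; have := small i; rewrite ltr_norml => /andP[+ _].
  have : (offset i).+1%:R <= (p (family i))%:R :> R by rewrite ler_nat.
  rewrite -natr1; lra.
- rewrite xi pmulr_rlt0 //; have := small i; rewrite ltr_norml => /andP[_ +].
  have : (p (family i)).+1%:R <= (offset i)%:R :> R by rewrite ler_nat.
  rewrite -natr1; lra.
Qed.

(** The difference of the two sides has coordinate 0 equal to 0 and satisfies the triangular system
    of the zones through [x]. *)
Lemma grid_line (p : nat -> nat) (x y : 'cV[R]_D.+2) :
  (forall j, (p j < m)%N) -> coord x 0 = 1 ->
  (forall i : 'I_n, offset i = p (family i) -> (grid_zones *m x) i 0 = 0) ->
  (forall i : 'I_n, offset i = p (family i) -> (grid_zones *m y) i 0 = 0) ->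
  y = coord y 0 *: x.
Proof.
move=> pm x0 px py; apply/eqP; rewrite -subr_eq0; apply/eqP.
apply: (@coord_eq0 (fun j => e * (-1) ^+ p j)).
  by rewrite -scaleNr coordD coordZ x0 mulr1 subrr.
move=> j jD; have [i fi oi] := exists_zone jD (pm j).
have : offset i = p (family i) by rewrite fi.
move=> /[dup] /px /eqP + /py /eqP; rewrite !grid_zones_eq0 fi oi x0 => /eqP hx /eqP hy.
rewrite -scaleNr !coordD !coordZ.
have := congr1 ( *%R (coord y 0)) hx; lra.
Qed.

(** The coefficients are the signs at the grid point, plus a free [l j] at the zone of family [j]
    through it. Cancelling column [j.+2] expresses [l j] by [l j.+1], with a factor [e] left over
    from the weights, so [|l j| < 1] persists. *)
Lemma grid_certificate (p : nat -> nat) : (forall j, (p j < m)%N) ->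
  exists s : 'rV[R]_n,
    [/\ forall i : 'I_n, offset i = p (family i) -> `|s 0 i| < 1,
        forall i : 'I_n, (offset i < p (family i))%N -> s 0 i = 1,
        forall i : 'I_n, (p (family i) < offset i)%N -> s 0 i = -1 &
        forall c : 'I_D.+2, (1 < c)%N -> (s *m grid_zones) 0 c = 0].
Proof.
move=> pm.
have n0 : 0 <= n%:R :> R by [].
have e1 : e * (n%:R + 1) < 1 / 2 by have := e_small; rewrite -[n.+1%:R]natr1; lra.
pose sgn q k : R := (k < q)%:R - (q < k)%:R.
pose T j := \sum_(i < n | family i == j) sgn (p j) (offset i).
have T_le j : `|T j| <= n%:R.
  apply: le_trans (ler_norm_sum _ _ _) _; rewrite big_mkcond /=.
  have -> : n%:R = \sum_(i < n) 1 :> R by rewrite sumr_const card_ord.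
  apply: ler_sum => i _; case: ifP => // _; rewrite /sgn.
  by case: ltngtP; rewrite ?subr0 ?sub0r ?subrr ?normrN ?normr1 ?normr0.
pose g j (v : R) := - (-1) ^+ p j * (e * (T j.+1 + v)).
pose P (v : R) : Prop := `|v| < 1.
have gP j v : (j < D)%N -> P v -> P (g j v).
  move=> _ Pv; rewrite /P /g normrM normrN normr_sign mul1r normrM gtr0_norm //.
  have : e * `|T j.+1 + v| <= e * (n%:R + 1).
    rewrite ler_pM2l //; apply: le_trans (ler_normD _ _) _.
    by rewrite lerD // ltW.
  by lra.
have P0 : P 0 by rewrite /P normr0 ltr01.
have [l [lP lN lg]] := backward_recursion P0 gP.
pose s : 'rV[R]_n := \row_i (sgn (p (family i)) (offset i) +
  (offset i == p (family i))%:R * l (family i)).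
exists s; split=> [i oi|i oi|i oi|c c2].
- by rewrite mxE /sgn oi ltnn eqxx subrr add0r mul1r; apply: lP; apply: family_le.
- by rewrite mxE /sgn oi (ltn_eqF oi) ltnNge (ltnW oi) /= subr0 mul0r addr0.
- by rewrite mxE /sgn oi (gtn_eqF oi) ltnNge (ltnW oi) /= sub0r mul0r addr0.
have [j jD cj] : exists2 j, (j < D)%N & c = j.+2 :> nat.
  by case: c c2 => -[|[|c]] // hc _; exists c.
have sum_s k : (k <= D)%N -> \sum_(i < n | family i == k) s 0 i = T k + l k.
  move=> kD; have := sum_family_offset (fun=> l k) kD (pm k).
  move=> /= <-; rewrite /T -big_split /=.
  by apply: eq_bigr => i /eqP fi; rewrite mxE fi.
(* The signs cancel against the alternating perturbations, leaving only the zone through the grid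
   point. *)
have sum_alt : \sum_(i < n | family i == j) s 0 i * (-1) ^+ offset i =
    (-1) ^+ p j * l j.
  have jD' := ltnW jD.
  transitivity (\sum_(i < n | family i == j) sgn (p j) (offset i) * (-1) ^+ offset i +
     \sum_(i < n | family i == j) (offset i == p j)%:R * ((-1) ^+ offset i * l j)).
    rewrite -big_split; apply: eq_bigr => i /eqP fi; rewrite mxE fi /=; ring.
  rewrite (sum_family_offset (fun k => (-1) ^+ k * l j)) //.
  rewrite (sum_family (fun k => sgn (p j) k * (-1) ^+ k)) // alternating_sum.
  by rewrite leqNgt pm /= m_odd add0r.
(* Column [j.+2] is the leading column of family [j.+1] and the perturbed column of family [j]; no
   other family meets it. *)
transitivity ((e ^+ 2) ^+ j.+1 * (\sum_(i < n | family i == j.+1) s 0 i) +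
   (e ^+ 2) ^+ j * e * (\sum_(i < n | family i == j) s 0 i * (-1) ^+ offset i)).
  rewrite !mulr_sumr (big_mkcond (fun i : 'I_n => family i == j.+1)).
  rewrite (big_mkcond (fun i : 'I_n => family i == j)) -big_split mxE /=.
  apply: eq_bigr => i _; rewrite [grid_zones i c]mxE cj !eqSS !(eq_sym _ (family i)) /=.
  case: eqP => [->|_]; case: eqP => [->|_]; rewrite /=; ring.
rewrite sum_s // sum_alt (lg j) // /g.
transitivity ((e ^+ 2) ^+ j * e ^+ 2 * (T j.+1 + l j.+1) * (1 - ((-1) ^+ p j) ^+ 2)).
  rewrite [_ ^+ j.+1]exprS; move: ((-1) ^+ p j) ((e ^+ 2) ^+ j) => q h; ring.
by rewrite sqrr_sign subrr mulr0.
Qed.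

Let proj : 'M[R]_(2, D.+2) := \matrix_(r, c) (r == c :> nat)%:R.
Local Notation shadow := ((fun x => proj *m x + 0) @`
  [set x : 'cV[R]_D.+2 | zone_norm grid_zones x <= 1]).

(** The grid point, scaled to norm 1, with its certificate; [c] consists of the first two entries of
    [s *m grid_zones]. The last two clauses make [p] recoverable from the vertex. *)
Lemma grid_vertex (p : nat -> nat) : (forall j, (p j < m)%N) ->
  exists z : 'cV[R]_D.+2, [/\ zone_norm grid_zones z <= 1,
    vertices shadow (proj *m z + 0),
    forall y, zone_norm grid_zones y <= 1 ->
      proj *m y + 0 = proj *m z + 0 -> y = z &
    forall i : 'I_n, ((grid_zones *m z) i 0 == 0) = (offset i == p (family i))].
Proof.
move=> pm; have [x [x0 xz xpos xneg]] := grid_point pm.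
have [s [sz spos sneg sc]] := grid_certificate pm.
have Nx : 0 < zone_norm grid_zones x.
  rewrite lt_def zone_norm_ge0 andbT; apply/eqP => Nx0.
  have ax0 : grid_zones *m x = 0.
    apply/matrixP => i k; rewrite ord1 [RHS]mxE; apply/eqP.
    rewrite -normr_eq0; apply/eqP.
    exact: (psumr_eq0P (fun i _ => normr_ge0 ((grid_zones *m x) i 0)) Nx0).
  move: x0; rewrite (row_full_ker0 grid_zones_full ax0) /coord mxE /= => /eqP.
  by rewrite eq_sym oner_eq0.
pose t := (zone_norm grid_zones x)^-1; have t_gt0 : 0 < t by rewrite invr_gt0.
pose c : 'rV[R]_2 := \row_r (s *m grid_zones) 0 (inord r).
have az i : (grid_zones *m (t *: x)) i 0 = t * (grid_zones *m x) i 0.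
  by rewrite -scalemxAr [LHS]mxE.
have Nz : zone_norm grid_zones (t *: x) = 1.
  by rewrite zone_normZ gtr0_norm // mulVf // gt_eqF.
have sE : s *m grid_zones = c *m proj.
  apply/matrixP => i q; rewrite ord1 [RHS]mxE.
  have [q2|q2] := ltnP 1 q.
    rewrite sc // big1 // => r _; rewrite [proj r q]mxE.
    by rewrite (ltn_eqF (leq_ltn_trans (_ : r <= 1)%N q2)) ?mulr0 // -ltnS.
  rewrite (bigD1 (inord q)) //= big1 ?addr0 => [|r rq].
    rewrite [c 0 _]mxE [proj _ _]mxE inordK ?ltnS // eqxx mulr1.
    by rewrite inord_val.
  rewrite [proj r q]mxE; case: eqP => [rq'|]; last by rewrite mulr0.
  by case/eqP: rq; apply: val_inj; rewrite /= inordK ?ltnS.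
have [|||Vz inj_z] := @certified_vertex _ _ _ grid_zones proj 0 s c (t *: x) _ _ Nz sE.
- move=> i; case: (ltngtP (offset i) (p (family i))) => h.
  + by rewrite spos // normr1.
  + by rewrite sneg // normrN normr1.
  + exact/ltW/sz.
- move=> i; rewrite az; case: (ltngtP (offset i) (p (family i))) => h.
  + by rewrite spos // mul1r gtr0_norm // mulr_gt0 // xpos.
  + by rewrite sneg // mulN1r ltr0_norm // pmulr_rlt0 // xneg.
  + by rewrite xz // mulr0 mulr0 normr0.
- move=> y hy; exists (coord y 0 / t); rewrite scalerA divfK ?gt_eqF //.
  by apply: (grid_line pm x0 xz) => i hi; apply: hy; apply: sz.
exists (t *: x); split=> // [|i]; first by rewrite Nz.
rewrite az mulf_eq0 gt_eqF //=.
case: (ltngtP (offset i) (p (family i))) => h.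
- by rewrite gt_eqF // xpos.
- by rewrite lt_eqF // xneg.
- by rewrite xz // eqxx.
Qed.

Lemma card_grid_vertices : (`I_(m ^ D.+1) #<= vertices shadow)%card.
Proof.
pose ext (g : {ffun 'I_D.+1 -> 'I_m}) (j : nat) : nat := g (inord j).
have ext_lt g j : (ext g j < m)%N by apply: ltn_ord.
have [Z hZ] := choice (fun g => grid_vertex (ext_lt g)).
have Z_inj : injective (fun g => proj *m Z g + 0).
  (* Equal vertices have equal preimages, hence the same vanishing zones, hence the same offsets. *)
  move=> g g' /= eqZ; have [Ng _ _ Zg] := hZ g; have [_ _ inj' Zg'] := hZ g'.
  have ZZ := inj' _ Ng eqZ.
  apply/ffunP => j; apply: val_inj => /=.
  have jD : (j <= D)%N by rewrite -ltnS ltn_ord.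
  have [i fi oi] := exists_zone jD (ext_lt g j).
  have := Zg i; rewrite ZZ Zg' fi oi eqxx => /eqP.
  by rewrite /ext !inord_val.
have := card_setT_fintype {ffun 'I_D.+1 -> 'I_m}; rewrite card_ffun !card_ord.
rewrite card_eq_sym card_eq_le => /andP[le_setT _]; apply: card_le_trans le_setT _.
have := inj_card_eq (A := setT) (in2W Z_inj).
rewrite card_eq_sym card_eq_le => /andP[le_im _].
apply: card_le_trans le_im _; apply: subset_card_le => _ [g _ <-].
by have [] := hZ g.
Qed.

End Grid.

(** * Assembling the two bounds *)

Lemma card_dual_shadow_vertices (R : realType) (d n : nat) (Z : set 'cV[R]_d)
    (S : set 'cV[R]_2) : (0 < n)%N -> dual_zonotope n Z -> shadow2 Z S ->
  (vertices S #<= `I_(2 * n ^ d.-1))%card.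
Proof.
move=> n0 [a [a_full _ _] ->] [f [A [b fE]] ->].
rewrite dual_zonotopeE (_ : f = fun x => A *m x + b); last exact/funext.
exact: card_shadow_vertices.
Qed.

(** With [t] the quotient of [n] by [D.+1], take [t] or [t - 1]. The factor 3 is needed for even
    [t >= 2], where [t + 1 <= 3 (t - 1)]. *)
Lemma exists_odd_grid_size (D n : nat) : (D.+2 <= n)%N ->
  exists m, [/\ odd m, (D.+1 * m <= n)%N & (n <= 3 * D.+1 * m)%N].
Proof.
move=> Dn; pose t := (n %/ D.+1)%N.
have t0 : (0 < t)%N by rewrite divn_gt0 // ltnW.
have tn : (D.+1 * t <= n)%N by rewrite mulnC leq_divM.
have nt : (n <= D.+1 * t.+1)%N by rewrite mulnC ltnW // ltn_ceil.
have [t_odd|t_even] := boolP (odd t).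
  exists t; split=> //; apply: leq_trans nt _.
  by rewrite -mulnA mulnCA leq_mul2l /=; lia.
exists t.-1; split; first by rewrite -[odd _]negbK -oddS prednK.
  by apply: leq_trans tn; rewrite leq_mul2l leq_pred orbT.
apply: leq_trans nt _; rewrite -mulnA mulnCA leq_mul2l /=.
have : t != 1%N by apply: contraNneq t_even => ->.
by lia.
Qed.

Lemma exists_large_shadow (R : realType) (D n m : nat) :
  odd m -> (D.+1 * m <= n)%N -> (D.+2 <= n)%N ->
  exists (Z : set 'cV[R]_D.+2) (S : set 'cV[R]_2),
    [/\ dual_zonotope n Z, shadow2 Z S & (`I_(m ^ D.+1) #<= vertices S)%card].
Proof.
move=> m_odd Dm D2.
(* The extra 1 makes [e * (2 * n.+1%:R) < 1] strict. *)
pose e : R := (2 * n.+1%:R + 1)^-1.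
have n0 : 0 < n.+1%:R :> R by [].
have e0 : 0 < e by rewrite invr_gt0; lra.
have e1 : e * (2 * n.+1%:R) < 1 by rewrite mulrC ltr_pdivrMr; lra.
pose a := grid_zones D m n e.
pose A : 'M[R]_(2, D.+2) := \matrix_(r, c) (r == c :> nat)%:R.
exists [set x | zone_norm a x <= 1],
  ((fun x => A *m x + 0) @` [set x | zone_norm a x <= 1]).
split; last exact: card_grid_vertices.
  by exists a; [apply: grid_zone_vectors | rewrite dual_zonotopeE].
by exists (fun x => A *m x + 0) => //; exists A, 0.
Qed.

Theorem theorem1 (R : realType) (d : nat) (hd : (2 <= d)%N) :
  exists M : nat -> nat,
    (forall n : nat, (d <= n)%N -> max_shadow_vertices R d n (M n)) /\
    (fun n : nat => (M n)%:R : R^o) \is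
      'Theta_\oo (fun n : nat => n%:R ^+ (d - 1) : R^o).
Proof.
case: d hd => [|[|D]] // _; rewrite subn1 /=.
have hM n : exists k, (D.+2 <= n)%N -> max_shadow_vertices R D.+2 n k /\
    forall m, odd m -> (D.+1 * m <= n)%N -> (m ^ D.+1 <= k <= 2 * n ^ D.+1)%N.
  (* Below the dimension the claim is vacuous and 0 is a filler value. *)
  have [Dn|] := leqP D.+2 n; last by exists 0%N.
  have n0 : (0 < n)%N by apply: leq_trans Dn.
  (* The maximum is taken over the attained vertex numbers: they are bounded by the upper bound, and
     the grid shows that there is one. *)
  pose Q k := `[< exists (Z : set 'cV[R]_D.+2) (S : set 'cV[R]_2),
    [/\ dual_zonotope n Z, shadow2 Z S & (vertices S #= `I_k)%card] >].
  have ubQ k : Q k -> (k <= 2 * n ^ D.+1)%N.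
    move=> /asboolP[Z [S [hZ hS hk]]].
    by rewrite -card_le_II -(card_le_eql hk) (card_dual_shadow_vertices n0 hZ hS).
  have fin (Z : set 'cV[R]_D.+2) (S : set 'cV[R]_2) :
      dual_zonotope n Z -> shadow2 Z S ->
      exists2 k, Q k & (vertices S #= `I_k)%card.
    move=> hZ hS; have /finite_setP[k hk] : finite_set (vertices S).
      apply/finite_set_leP; exists (2 * n ^ D.+1)%N.
      exact: (card_dual_shadow_vertices n0 hZ hS).
    by exists k => //; apply/asboolP; exists Z, S.
  have large m : odd m -> (D.+1 * m <= n)%N -> exists2 k, Q k & (m ^ D.+1 <= k)%N.
    move=> m_odd Dm; have [Z [S [hZ hS le_S]]] := exists_large_shadow R m_odd Dm Dn.
    have [k Qk hk] := fin _ _ hZ hS; exists k => //.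
    by rewrite -card_le_II -(card_le_eqr hk).
  have exQ : exists k, Q k.
    have [m [m_odd Dm _]] := exists_odd_grid_size Dn.
    by have [k Qk _] := large m m_odd Dm; exists k.
  have [k Qk kmax] := ex_maxnP exQ ubQ.
  exists k => _; split; last first.
    move=> m m_odd Dm; rewrite ubQ // andbT.
    by have [k' Qk' /leq_trans] := large m m_odd Dm; apply; apply: kmax.
  split; first exact/asboolP.
  move=> Z S hZ hS; have [k' Qk' hk'] := fin Z S hZ hS.
  by rewrite (card_le_eql hk') card_le_II kmax.
have [M MP] := choice hM; exists M; split=> [n /MP[]//|].
(* From [n <= 3 * D.+1 * m] and [m ^ D.+1 <= M n] follows [n ^ D.+1 <= K * M n]. *)
apply/asboolP; pose K : R := (3 * D.+1)%:R ^+ D.+1.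
have K0 : 0 < K by rewrite exprn_gt0 // ltr0n.
exists (K^-1, 2); first by rewrite /= invr_gt0 K0 ltr0n.
near=> n.
have Dn : (D.+2 <= n)%N by near: n; exists D.+2.
have [m [m_odd Dm nm]] := exists_odd_grid_size Dn.
have [_ /(_ m m_odd Dm) /andP[mM Mn]] := MP n Dn.
rewrite -natrX !normr_nat -natrM ler_nat; split=> //.
rewrite mulrC ler_pdivrMr // /K -natrX -natrM ler_nat.
apply: (@leq_trans ((3 * D.+1 * m) ^ D.+1)%N); first by rewrite leq_exp2r.
by rewrite expnMn mulnC leq_mul2r mM orbT.
Unshelve. all: by end_near.
Qed.
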